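(* Let $S$ be a polynomial ring over a field, let $I \subseteq S$ be a monomial ideal, and let $x$ be a variable appearing in $I$. Then \[ \operatorname{reg}(I) \leq \max\{ \operatorname{reg} (I : x) + 1,\ \operatorname{reg} (I,x)\}. \] Moreover, $\operatorname{reg}(I)$ is equal to one of the two terms $\operatorname{reg}(I:x)+1$, $\operatorname{reg}(I,x)$.
   Context: $S$ is a standard graded polynomial ring over a field $K$. A variable $x$ appears in $I$ if it divides some minimal monomial generator of $I$. $(I,x)$ denotes the ideal $I+(x)$ and $(I:x)=\{f\in S: xf\in I\}$. The Castelnuovo–Mumford regularity of a graded $S$-module $M$ is $\operatorname{reg}(M)=\max\{\,j-m : \operatorname{Tor}^S_m(M,K)_j\neq 0\,\}$. *)

(* Defs.v *)
From Stdlib Require Import ClassicalEpsilon.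
From mathcomp Require Import all_boot all_order all_algebra.
From mathcomp.multinomials Require Import mpoly.

Set Implicit Arguments.
Unset Strict Implicit.
Unset Printing Implicit Defensive.

Import Order.TTheory GRing.Theory Num.Theory.
Local Open Scope ring_scope.

(* Ideals are Prop-valued predicates: MathComp's [idealr_closed] is boolean and
   only covers proper ideals, whereas a colon ideal may be the unit ideal. *)

Definition ideal_gen (R : comNzRingType) (A : R -> Prop) (f : R) : Prop :=
  exists s : seq (R * R),
    (forall q, q \in s -> A q.2) /\ f = \sum_(q <- s) q.1 * q.2.

Definition ideal_colon (R : comNzRingType) (I : R -> Prop) (x f : R) : Prop :=
  I (x * f).

Definition ideal_add (R : comNzRingType) (I : R -> Prop) (x f : R) : Prop :=
  exists g h : R, I g /\ f = g + h * x.

Section Monomial.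
Context (K : fieldType) (n : nat).
Local Notation S := {mpoly K[n]}.

Definition monomial_ideal (I : S -> Prop) : Prop :=
  exists G : 'X_{1..n} -> Prop,
    forall f, I f <-> ideal_gen (fun g => exists2 m, G m & g = 'X_[m]) f.

Definition min_generator (I : S -> Prop) (m : 'X_{1..n}) : Prop :=
  I 'X_[m] /\ (forall m', I 'X_[m'] -> (m' <= m)%MM -> m' = m).

Definition appears_in (I : S -> Prop) (x : 'I_n) : Prop :=
  exists2 m, min_generator I m & (0 < m x)%N.

End Monomial.

Section Regularity.
Context (K : fieldType) (n : nat).
Local Notation S := {mpoly K[n]}.

(* Homogeneous of degree [d], where only 0 is homogeneous of negative degree. *)
Definition zhomog (d : int) (f : S) : Prop :=
  match d with
  | Posz k => f \is k.-homog
  | Negz _ => f = 0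
  end.

(* A graded free resolution of K = S/(x_1, ..., x_n),
     ... -> F_2 -> F_1 -> F_0 -> K -> 0,
   with F_m = \bigoplus_i S(- res_deg m i) of rank [res_rk m].  Elements of F_m
   are row vectors, differentials act by right multiplication, and S acts on K
   through the constant coefficient. *)
Record graded_resolution := GradedResolution {
  res_rk : nat -> nat;
  res_deg : forall m, 'I_(res_rk m) -> int;
  res_d : forall m, 'M[S]_(res_rk m.+1, res_rk m);
  res_aug : 'cV[K]_(res_rk 0);
  res_d_homog : forall m i k,
    zhomog (res_deg i - res_deg k) (res_d m i k);
  res_aug_homog : forall i, res_aug i 0 != 0 -> res_deg i = 0;
  res_aug_surj : forall c : 'M[K]_1,
    exists v : 'rV[S]_(res_rk 0), map_mx (mcoeff 0%MM) v *m res_aug = c;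
  res_exact0 : forall v : 'rV[S]_(res_rk 0),
    map_mx (mcoeff 0%MM) v *m res_aug = 0 <-> exists w, v = w *m res_d 0;
  res_exactS : forall m (v : 'rV[S]_(res_rk m.+1)),
    v *m res_d m = 0 <-> exists w, v = w *m res_d m.+1
}.

(* The degree [j] part of I \otimes_S F_m = \bigoplus_i I(- res_deg m i). *)
Definition tensor_deg (F : graded_resolution) (I : S -> Prop) (m : nat)
    (j : int) (v : 'rV[S]_(res_rk F m)) : Prop :=
  forall i, I (v 0 i) /\ zhomog (j - res_deg i) (v 0 i).

Definition tensor_cycle (F : graded_resolution) (m : nat) :
    'rV[S]_(res_rk F m) -> Prop :=
  match m with
  | 0 => fun _ => True
  | m'.+1 => fun v => v *m res_d F m' = 0
  end.

(* Tor_m^S(I, K)_j <> 0, where Tor_m^S(I, K) = H_m(I \otimes_S F) for a graded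
   free resolution F of K; the choice of F is immaterial. *)
Definition Tor_neq0 (I : S -> Prop) (m : nat) (j : int) : Prop :=
  exists (F : graded_resolution) (v : 'rV[S]_(res_rk F m)),
    [/\ tensor_deg I j v, tensor_cycle v &
        ~ (exists2 w : 'rV[S]_(res_rk F m.+1),
             tensor_deg I j w & v = w *m res_d F m)].

Definition is_reg (I : S -> Prop) (r : int) : Prop :=
  (exists m j, Tor_neq0 I m j /\ r = j - m%:Z) /\
  (forall m j, Tor_neq0 I m j -> j - m%:Z <= r).

(* The maximum exists for every nonzero homogeneous ideal; the value at an ideal
   for which it does not exist (such as 0) is arbitrary. *)
Definition reg (I : S -> Prop) : int := epsilon (inhabits 0) (is_reg I).

End Regularity.

(* Main.v *)
(* Tor over any graded resolution of K agrees with Tor over the Koszul complex,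
   by the usual comparison maps and a homotopy.  For a monomial ideal I the
   Koszul complex splits by multidegree: Tor_m(I, K)_a is H_m of the upper
   Koszul simplicial complex D_a(I) = {s : x^(a - s) in I}, graded by
   cardinality.  So reg I is the maximum of |a| - m over the nonzero groups
   H_m(D_a(I)); it exists by Dickson's lemma.

   Let e be the exponent of x.  If a_x > 0 then D_a(I : x) = D_(a+e)(I).  If
   a_x = 0 then, in D_(a+e)(I), the deletion of x is D_a(I : x) and the link of
   x is D_a(I) = D_a(I, x).  The exact sequence of deletion, complex and link
   gives reg I <= max(reg (I : x) + 1, reg (I, x)), and also
   reg (I : x) + 1 <= reg I as soon as reg (I, x) < reg I.  Finally
   reg (I, x) <= reg I: the complex D_(a+e)(I, x) is a cone if a_x > 0, and if
   a_x = 0 its deletion is a full simplex, so that only the link D_a(I)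
   contributes, apart from H_0 at a = 0, of value 1 <= reg I. *)
Require Import Defs.
From HB Require Import structures.
From Stdlib Require Import ClassicalEpsilon.
From mathcomp Require Import all_boot all_order all_algebra.
From mathcomp Require Import zify.
From mathcomp.multinomials Require Import mpoly.

Set Implicit Arguments.
Unset Strict Implicit.
Unset Printing Implicit Defensive.

Import Order.TTheory GRing.Theory Num.Theory.
Local Open Scope ring_scope.

(** * Signed simplicial chains *)

Section Chains.
Context (K : comNzRingType) (n : nat).
Local Notation chain := {ffun {set 'I_n} -> K}.
Implicit Types (c b : chain) (s t : {set 'I_n}) (i k l : 'I_n).

Definition face_sign k s : K := (-1) ^+ #|[set l in s | (l < k)%N]|.

Lemma face_signM k s : face_sign k s * face_sign k s = 1.
Proof. by rewrite -expr2 sqrr_sign. Qed.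

Lemma face_signU k l s : l \notin s ->
  face_sign k (l |: s) = (-1) ^+ (l < k)%N * face_sign k s.
Proof.
move=> ls; rewrite /face_sign -exprD; congr (_ ^+ _).
case: ltnP => lk.
  have -> : [set j in l |: s | (j < k)%N] = l |: [set j in s | (j < k)%N].
    by apply/setP => j; rewrite !inE andb_orl; case: eqP => // ->; rewrite lk.
  by rewrite cardsU1 inE (negbTE ls).
congr (#|pred_of_set _|); apply/setP => j; rewrite !inE andb_orl.
by case: eqP => // ->; rewrite ltnNge lk.
Qed.

Lemma face_signU1 k s : face_sign k (k |: s) = face_sign k s.
Proof.
case: (boolP (k \in s)) => [ks|ks]; last by rewrite face_signU // ltnn mul1r.
by congr face_sign; apply/setUidPr; rewrite sub1set.
Qed.

(** In the exterior algebra on the vertices, [del k] is contraction by the dual of vertex [k], and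
    [ext k] is left multiplication by that vertex. Splitting the boundary by vertices reduces sign
    computations to the commutation relations of these maps. *)
Definition del k c : chain :=
  [ffun s : {set 'I_n} => if k \in s then 0 else face_sign k s * c (k |: s)].

Definition ext k c : chain :=
  [ffun s : {set 'I_n} => if k \in s then face_sign k s * c (s :\ k) else 0].

Lemma del_is_zmod_morphism k : zmod_morphism (del k).
Proof.
move=> c b; apply/ffunP => s; rewrite !ffunE.
by case: ifP => _; rewrite ?subr0 // mulrBr.
Qed.
HB.instance Definition _ k :=
  GRing.isZmodMorphism.Build chain chain (del k) (del_is_zmod_morphism k).

Lemma ext_is_zmod_morphism k : zmod_morphism (ext k).
Proof.
move=> c b; apply/ffunP => s; rewrite !ffunE.
by case: ifP => _; rewrite ?subr0 // mulrBr.
Qed.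
HB.instance Definition _ k :=
  GRing.isZmodMorphism.Build chain chain (ext k) (ext_is_zmod_morphism k).

Definition bd c : chain := \sum_k del k c.

Lemma bd_is_zmod_morphism : zmod_morphism bd.
Proof.
by move=> c b; rewrite /bd -sumrB; apply: eq_bigr => k _; rewrite raddfB.
Qed.
HB.instance Definition _ :=
  GRing.isZmodMorphism.Build chain chain bd bd_is_zmod_morphism.

Lemma bdE c s : bd c s = \sum_(k | k \notin s) face_sign k s * c (k |: s).
Proof.
rewrite /bd sum_ffunE [in RHS]big_mkcond; apply: eq_bigr => k _.
by rewrite ffunE; case: ifP.
Qed.

Lemma delK k c : del k (del k c) = 0.
Proof.
apply/ffunP => s; rewrite !ffunE; case: ifP => // _.
by rewrite !inE eqxx mulr0.
Qed.

Lemma neq_sign k l : k != l ->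
  (-1) ^+ (l < k)%N = - (-1) ^+ (k < l)%N :> K.
Proof.
by rewrite -val_eqE /=; case: ltngtP => // _ _; rewrite ?expr0 ?expr1 ?opprK.
Qed.

Lemma delC k l c : del k (del l c) = - del l (del k c).
Proof.
have [->|kl] := eqVneq k l; first by rewrite delK oppr0.
have lk : (l == k) = false by rewrite eq_sym (negbTE kl).
apply/ffunP => s; rewrite !ffunE !inE lk (negbTE kl) /=.
case: (boolP (k \in s)) => ks; case: (boolP (l \in s)) => ls;
  rewrite ?mulr0 ?oppr0 //.
rewrite !face_signU // (neq_sign kl) !mulNr mulrN opprK setUCA !mulrA.
by congr (_ * _); rewrite mulrC mulrA mulrAC.
Qed.

Lemma del_ext k l c : k != l -> del k (ext l c) = - ext l (del k c).
Proof.
move=> kl; have lk : (l == k) = false by rewrite eq_sym (negbTE kl).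
apply/ffunP => s; rewrite !ffunE !inE lk (negbTE kl) /=.
case: (boolP (k \in s)) => ks; case: (boolP (l \in s)) => ls;
  rewrite ?mulr0 ?oppr0 //.
have lsl : l \notin s :\ l by rewrite !inE eqxx.
rewrite -{1 3}(setD1K ls) !face_signU ?(setD1K ls) ?ks //; last first.
have -> : (k |: s) :\ l = k |: (s :\ l).
  by apply/setP => j; rewrite !inE; case: eqP => //= ->; rewrite lk.
rewrite -[in face_sign l s](setD1K ls) face_signU1 (neq_sign kl) !mulNr.
congr (- _); rewrite -!mulrA [face_sign k _ * (_ * _)]mulrCA.
by rewrite signrMK mulrCA.
Qed.

Lemma del_ext_id k c : del k (ext k c) = c - ext k (del k c).
Proof.
apply/ffunP => s; rewrite !ffunE !inE eqxx /=.
case: (boolP (k \in s)) => ks /=.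
  rewrite -{2}(setD1K ks) face_signU1 mulrA face_signM mul1r setD1K //.
  by rewrite subrr.
by rewrite face_signU1 mulrA face_signM mul1r setU1K // subr0.
Qed.

Lemma del_bd k c : del k (bd c) = - bd (del k c).
Proof.
rewrite raddf_sum /bd -sumrN; apply: eq_bigr => l _; exact: delC.
Qed.

(** The term of vertex [k] contributes the identity and the others anticommute with [ext k], which
    is thus a contracting homotopy of the full simplex. *)
Lemma bd_ext k c : bd (ext k c) = c - ext k (bd c).
Proof.
rewrite {1}/bd (bigD1 k) //= del_ext_id /bd raddf_sum [in RHS](bigD1 k) //=.
rewrite opprD addrA; congr (_ + _); rewrite -sumrN.
by apply: eq_bigr => l lk; rewrite del_ext.
Qed.

(** Anticommutation cancels the terms of (k, l) and (l, k). The diagonal terms vanish by [delK], so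
    the argument holds in every characteristic. *)
Lemma bdK c : bd (bd c) = 0.
Proof.
pose D := \sum_(k < n) \sum_(l < n | (l < k)%N) del k (del l c).
have E : bd (bd c) = D + \sum_(k < n) \sum_(l < n | (k < l)%N) del k (del l c).
  rewrite -big_split; apply: eq_bigr => k _; rewrite raddf_sum.
  rewrite (bigID (fun l : 'I_n => (l < k)%N)) /=; congr (_ + _).
  rewrite (bigD1 k) ?ltnn //= delK add0r; apply: eq_bigl => l.
  by rewrite -leqNgt ltn_neqAle andbC eq_sym.
rewrite E (exchange_big_dep predT) //= -big_split big1 // => k _ /=.
rewrite -big_split big1 // => l _ /=; first by rewrite delC addNr.
Qed.

Lemma bd_card0 c : (forall s, c s != 0 -> #|s| = 0%N) -> bd c = 0.
Proof.
move=> h; apply/ffunP => s; rewrite bdE big1 ?ffunE // => k ks.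
have [->|/h] := eqVneq (c (k |: s)) 0; first by rewrite mulr0.
by rewrite cardsU1 ks.
Qed.

Lemma del_neq0 k c s : del k c s != 0 -> k \notin s /\ c (k |: s) != 0.
Proof.
by rewrite ffunE; case: (k \in s); rewrite ?eqxx // => h; split=> //;
  apply: contraNneq h => ->; rewrite mulr0.
Qed.

Lemma ext_neq0 k c s : ext k c s != 0 -> k \in s /\ c (s :\ k) != 0.
Proof.
by rewrite ffunE; case: (k \in s); rewrite ?eqxx // => h; split=> //;
  apply: contraNneq h => ->; rewrite mulr0.
Qed.

Definition carried (P : {set 'I_n} -> Prop) (m : nat) c :=
  forall s, c s != 0 -> P s /\ #|s| = m.

(* With this indexing by cardinality, [hom_neq0 P m] says that the reduced
   simplicial homology of [P] in dimension [m - 1] is nonzero. *)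
Definition hom_neq0 (P : {set 'I_n} -> Prop) (m : nat) :=
  exists c, [/\ carried P m c, bd c = 0 &
                ~ exists2 b, carried P m.+1 b & bd b = c].

Lemma carriedD P m c b : carried P m c -> carried P m b -> carried P m (c + b).
Proof.
move=> hc hb s; rewrite ffunE; have [->|/hc//] := eqVneq (c s) 0.
by rewrite add0r => /hb.
Qed.

Lemma carriedN P m c : carried P m c -> carried P m (- c).
Proof. by move=> h s; rewrite ffunE oppr_eq0 => /h. Qed.

Lemma carried_del i (P : {set 'I_n} -> Prop) m c : carried P m.+1 c ->
  carried (fun s => i \notin s /\ P (i |: s)) m (del i c).
Proof.
move=> h s /del_neq0[iNs /h[Ps]].
by rewrite cardsU1 iNs => -[].
Qed.

Lemma carried_ext i (P : {set 'I_n} -> Prop) m c :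
  carried (fun s => i \notin s /\ P (i |: s)) m c -> carried P m.+1 (ext i c).
Proof.
move=> h s /ext_neq0[iNs /h[[_]]]; rewrite setD1K // => Ps <-.
by rewrite (cardsD1 i s) iNs.
Qed.

Lemma hom_neq0_ext P Q m : (forall s, P s <-> Q s) ->
  hom_neq0 P m -> hom_neq0 Q m.
Proof.
move=> PQ [c [hc bc nb]]; exists c; split=> //.
  by move=> s /hc[/PQ].
by case=> b hb e; apply: nb; exists b => // s /hb[/PQ].
Qed.

(** The homotopy [ext k] stays inside a cone with apex [k], so it provides a bounding chain for
    every cycle. *)
Lemma cone_boundary k (P : {set 'I_n} -> Prop) m c :
  (forall s, P s -> P (k |: s)) -> carried P m c -> bd c = 0 ->
  exists2 b, carried P m.+1 b & bd b = c.
Proof.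
move=> cone hc bc; exists (ext k c); last by rewrite bd_ext bc raddf0 subr0.
move=> s /ext_neq0[ks /hc[/cone]]; rewrite setD1K // => Ps <-; split=> //.
by rewrite (cardsD1 k s) ks.
Qed.

Lemma hom_cone k (P : {set 'I_n} -> Prop) m :
  (forall s, P s -> P (k |: s)) -> ~ hom_neq0 P m.
Proof.
move=> cone [c [hc bc]]; apply; exact: cone_boundary cone hc bc.
Qed.

(** * Exactness for the deletion and the link of a vertex *)

Section DeletionLink.
Variables (i : 'I_n) (P : {set 'I_n} -> Prop).
Hypothesis P_down : forall s, i \notin s -> P (i |: s) -> P s.
Local Notation deletion := (fun s => i \notin s /\ P s).
Local Notation link := (fun s => i \notin s /\ P (i |: s)).

(* Adding [bd (ext i f)] removes from [b] all the faces containing [i]. *)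
Lemma push_off m b f : carried P m b -> carried link m f ->
  bd f = del i b -> carried deletion m (b + bd (ext i f)).
Proof.
move=> hb hf e; rewrite bd_ext e addrCA.
(* This is the part of [b] on faces avoiding [i], in a form whose support can be read off. *)
have -> : b - ext i (del i b) = del i (ext i b).
  by rewrite del_ext_id.
apply: carriedD.
  by move=> s /hf[[iNs /(P_down iNs)]].
move=> s /del_neq0[iNs /ext_neq0[_]]; rewrite setU1K // => /hb[Ps es].
by split.
Qed.

(** Exactness at the homology of [P]: if [del i c] bounds in the link, [push_off] moves [c] into the
    deletion within its class; otherwise [del i c] is itself a nonzero class of the link. For [m] =
    0 the only possible face is the empty one, which avoids [i]. *)
Lemma hom_deletion_or_link m : hom_neq0 P m ->
  hom_neq0 deletion m \/ exists2 m', m = m'.+1 & hom_neq0 link m'.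
Proof.
case: m => [|m] [c [hc bc nb]].
  left; exists c; split=> //.
    move=> s /[dup] cs /hc[Ps /eqP]; rewrite cards_eq0 => /eqP s0.
    by split; rewrite ?s0 ?cards0 ?inE // -s0.
  by case=> b hb e; apply: nb; exists b => // s /hb[[]].
have [[f hf e]|nl] :=
  classic (exists2 f, carried link m.+1 f & bd f = del i c).
- left; exists (c + bd (ext i f)); split; first exact: push_off.
    by rewrite raddfD /= bc bdK addr0.
  case=> b hb eb; apply: nb; exists (b - ext i f); last first.
    by rewrite raddfB /= eb addrK.
  apply: carriedD; first by move=> s /hb[[]].
  exact/carriedN/carried_ext.
- right; exists m => //; exists (del i c); split=> //; first exact: carried_del.
  by apply/eqP; rewrite -oppr_eq0 -del_bd bc raddf0.
Qed.

(** Exactness at the homology of the deletion: a class that becomes the boundary of some [b] in [P]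
    comes, up to sign, from the class of [del i b] in the link. If [del i b] bounded there,
    [push_off] would move [b] into the deletion. *)
Lemma hom_deletion m : hom_neq0 deletion m -> hom_neq0 P m \/ hom_neq0 link m.
Proof.
case=> c [hc bc nb].
have [[b hb e]|nP] := classic (exists2 b, carried P m.+1 b & bd b = c);
  last first.
  by left; exists c; split=> // s /hc[[]].
right; exists (del i b); split; first exact: carried_del.
  apply/eqP; rewrite -oppr_eq0 -del_bd e; apply/eqP/ffunP => s.
  rewrite !ffunE; case: ifP => // iNs.
  have [->|/hc[[]]] := eqVneq (c (i |: s)) 0; first by rewrite mulr0.
  by rewrite !inE eqxx.
case=> f hf ef; apply: nb; exists (b + bd (ext i f)); first exact: push_off.
by rewrite raddfD /= bdK addr0.
Qed.

End DeletionLink.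
End Chains.

(** * Independence of the graded resolution *)

Section Homogeneous.
Context (K : fieldType) (n : nat).
Local Notation S := {mpoly K[n]}.
Implicit Types (f g : S) (d e : int).

Lemma zhomogP d f :
  zhomog d f <-> forall u, f@_u != 0 -> (mdeg u)%:Z = d.
Proof.
case: d => d /=.
  split=> [/dhomogP h u|h]; first by rewrite -mcoeff_msupp => /h ->.
  by apply/dhomogP => u; rewrite mcoeff_msupp => /h [].
split=> [->|h] => [u|]; first by rewrite mcoeff0 eqxx.
by apply/mpolyP => u; rewrite mcoeff0; apply/eqP; apply: contraT => /h.
Qed.

Lemma zhomog0 d : zhomog d (0 : S).
Proof. by apply/zhomogP => u; rewrite mcoeff0 eqxx. Qed.

Lemma zhomogD d f g : zhomog d f -> zhomog d g -> zhomog d (f + g).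
Proof.
move=> /zhomogP hf /zhomogP hg; apply/zhomogP => u; rewrite mcoeffD.
by have [->|/hf//] := eqVneq f@_u 0; rewrite add0r => /hg.
Qed.

Lemma zhomogN d f : zhomog d f -> zhomog d (- f).
Proof.
by move=> /zhomogP hf; apply/zhomogP => u; rewrite mcoeffN oppr_eq0 => /hf.
Qed.

Lemma zhomog_sum (J : Type) (r : seq J) (P : pred J) d (F : J -> S) :
  (forall i, P i -> zhomog d (F i)) -> zhomog d (\sum_(i <- r | P i) F i).
Proof. by move=> h; elim/big_ind: _; [exact: zhomog0|exact: zhomogD|]. Qed.

Lemma mcoeffM_neq0 f g u : (f * g)@_u != 0 ->
  exists u1 u2, [/\ u = (u1 + u2)%MM, f@_u1 != 0 & g@_u2 != 0].
Proof.
rewrite -mcoeff_msupp => /msuppM_le /allpairsP[[u1 u2] [/=]].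
by rewrite !mcoeff_msupp => *; exists u1, u2.
Qed.

Lemma zhomogM d e f g : zhomog d f -> zhomog e g -> zhomog (d + e) (f * g).
Proof.
move=> /zhomogP hf /zhomogP hg; apply/zhomogP => u.
by move=> /mcoeffM_neq0[u1 [u2 [-> /hf <- /hg <-]]]; rewrite mdegD PoszD.
Qed.

Definition zpart d f : S :=
  \sum_(u <- msupp f | (mdeg u)%:Z == d) f@_u *: 'X_[u].

Lemma mcoeff_zpart d f u :
  (zpart d f)@_u = if (mdeg u)%:Z == d then f@_u else 0.
Proof.
rewrite /zpart raddf_sum /= big_mkcond /=.
have [uf|uf] := boolP (u \in msupp f); last first.
  rewrite big1_seq => [|v /andP[_ vf]].
    by rewrite (memN_msupp_eq0 uf) if_same.
  case: ifP => // _; rewrite mcoeffZ mcoeffX.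
  by case: eqP vf uf => [->->|]; rewrite ?mulr0.
rewrite (bigD1_seq u) ?msupp_uniq //= big1 ?addr0 => [|v vu].
  by rewrite mcoeffZ mcoeffX eqxx mulr1.
by rewrite mcoeffZ mcoeffX (negbTE vu) mulr0 if_same.
Qed.

Lemma zhomog_zpart d f : zhomog d (zpart d f).
Proof.
by apply/zhomogP => u; rewrite mcoeff_zpart; case: ifP => [/eqP//|_];
  rewrite eqxx.
Qed.

Lemma zpart_zhomog d f : zhomog d f -> zpart d f = f.
Proof.
move=> /zhomogP h; apply/mpolyP => u; rewrite mcoeff_zpart.
by have [->|/h->] := eqVneq f@_u 0; rewrite ?if_same ?eqxx.
Qed.

Lemma zpart_sum (J : finType) d (F : J -> S) :
  zpart d (\sum_i F i) = \sum_i zpart d (F i).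
Proof.
apply/mpolyP => u; rewrite mcoeff_zpart.
case: ifPn => du; rewrite !raddf_sum /=.
  by apply: eq_bigr => i _; rewrite mcoeff_zpart du.
by rewrite big1 // => i _; rewrite mcoeff_zpart (negbTE du).
Qed.

Lemma zpartM d e f g : zhomog e g -> zpart d (f * g) = zpart (d - e) f * g.
Proof.
move=> /zhomogP h; apply/mpolyP => u; rewrite mcoeff_zpart !mcoeffM.
have E (k : 'X_{1..n} * 'X_{1..n}) : u = (k.1 + k.2)%MM -> g@_k.2 != 0 ->
    ((mdeg k.1)%:Z == d - e) = ((mdeg u)%:Z == d).
  by move=> -> /h <-; rewrite mdegD PoszD -(inj_eq (addIr (mdeg k.2)%:Z)) subrK.
case: ifPn => du; [apply: eq_bigr|rewrite big1 //] => k /eqP uk;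
  have [->|gk] := eqVneq g@_k.2 0; rewrite ?mulr0 //;
  have := E (val k.1, val k.2) uk gk; rewrite /= mcoeff_zpart => ->.
  by rewrite du.
by rewrite (negbTE du) mul0r.
Qed.

(** These are the degree-preserving maps, acting on row vectors, between graded free modules with
    generators in degrees [e] and [e']. *)
Definition mx_homog p q (e : 'I_p -> int) (e' : 'I_q -> int) (M : 'M[S]_(p, q))
  :=
  forall i k, zhomog (e i - e' k) (M i k).

Lemma mx_homogM p q r (e1 : 'I_p -> int) (e2 : 'I_q -> int) (e3 : 'I_r -> int)
    (M : 'M[S]_(p, q)) (N : 'M[S]_(q, r)) :
  mx_homog e1 e2 M -> mx_homog e2 e3 N -> mx_homog e1 e3 (M *m N).
Proof.
move=> hM hN i k; rewrite mxE; apply: zhomog_sum => j _.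
have -> : e1 i - e3 k = (e1 i - e2 j) + (e2 j - e3 k) by rewrite subrKA.
exact: zhomogM.
Qed.

Lemma mx_homogB p q (e1 : 'I_p -> int) (e2 : 'I_q -> int) (M N : 'M[S]_(p, q)) :
  mx_homog e1 e2 M -> mx_homog e1 e2 N -> mx_homog e1 e2 (M - N).
Proof. by move=> hM hN i k; rewrite !mxE; apply/zhomogD/zhomogN. Qed.

Lemma mx_homog1 p (e : 'I_p -> int) : mx_homog e e 1%:M.
Proof.
move=> i k; rewrite mxE; case: eqP => [->|_]; last exact: zhomog0.
by rewrite subrr; apply: dhomog1.
Qed.

End Homogeneous.

(** * Comparison maps between graded resolutions *)

Section Comparison.
Context (K : fieldType) (n : nat).
Local Notation S := {mpoly K[n]}.
Implicit Types (F G : graded_resolution K n).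

(** Unlike in [tensor_cycle], the case [m] = 0 uses the augmentation, so that the cycles are exactly
    the images of the next differential. *)
Definition aug_cycle F (m : nat) : 'rV[S]_(res_rk F m) -> Prop :=
  match m with
  | 0 => fun v => map_mx (mcoeff 0%MM) v *m res_aug F = 0
  | m'.+1 => fun v => v *m res_d F m' = 0
  end.

Lemma aug_cycleP F m (v : 'rV[S]_(res_rk F m)) :
  aug_cycle v <-> exists w, v = w *m res_d F m.
Proof. by case: m v => [|m] v; [exact: res_exact0|exact: res_exactS]. Qed.

Lemma res_d_cycle F m i : aug_cycle (row i (res_d F m)).
Proof. by apply/aug_cycleP; exists (delta_mx 0 i); rewrite rowE. Qed.

Lemma aug_tensor_cycle F m (v : 'rV[S]_(res_rk F m)) :
  aug_cycle v -> tensor_cycle v.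
Proof. by case: m v. Qed.

(** Exactness lifts each row. Keeping only the component of the prescribed degree in each entry
    still gives a lift, since [M] and the differential are homogeneous. *)
Lemma homog_lift F m p (e : 'I_p -> int) (M : 'M[S]_(p, res_rk F m)) :
  mx_homog e (@res_deg _ _ F m) M -> (forall i, aug_cycle (row i M)) ->
  exists2 N : 'M[S]_(p, res_rk F m.+1),
    mx_homog e (@res_deg _ _ F m.+1) N & M = N *m res_d F m.
Proof.
move=> hM cM.
have /fin_all_exists2[w hw ew] (i : 'I_p) : exists2 w : 'rV[S]_(res_rk F m.+1),
    forall k, zhomog (e i - res_deg k) (w 0 k) & row i M = w *m res_d F m.
  have /aug_cycleP[w ew] := cM i.
  exists (\row_k zpart (e i - res_deg k) (w 0 k)) => [k|].
    by rewrite mxE; apply: zhomog_zpart.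
  apply/rowP => k; rewrite mxE -(zpart_zhomog (hM i k)).
  move/rowP/(_ k): ew; rewrite !mxE => ->; rewrite zpart_sum.
  apply: eq_bigr => j _; rewrite mxE (zpartM _ _ (res_d_homog j k)).
  by rewrite opprB addrA subrK.
exists (\matrix_i w i) => [i k|]; first by rewrite mxE.
by apply/row_matrixP => i; rewrite row_mul rowK ew.
Qed.

Lemma lift_aug F G : exists phi : 'M[S]_(res_rk F 0, res_rk G 0),
  mx_homog (@res_deg _ _ F 0) (@res_deg _ _ G 0) phi /\
  map_mx (mcoeff 0%MM) phi *m res_aug G = res_aug F.
Proof.
have /fin_all_exists2[w hw ew] (i : 'I_(res_rk F 0)) :
  exists2 w : 'rV[S]_(res_rk G 0),
    forall k, zhomog (res_deg i - res_deg k) (w 0 k) &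
    map_mx (mcoeff 0%MM) w *m res_aug G = row i (res_aug F).
  (* A generator with zero augmentation is sent to 0. Any other generator has degree 0, and passing
     to homogeneous parts keeps the constant coefficients at the entries where [res_aug G] is
     nonzero. *)
  have [z|nz] := eqVneq (res_aug F i 0) 0.
    exists 0 => [k|]; first by rewrite mxE; apply: zhomog0.
    by rewrite raddf0 mul0mx; apply/matrixP => a b; rewrite !ord1 !mxE z.
  have [w ew] := res_aug_surj G (row i (res_aug F)).
  exists (\row_k zpart (res_deg i - res_deg k) (w 0 k)) => [k|].
    by rewrite mxE; apply: zhomog_zpart.
  rewrite -ew; apply/matrixP => a b; rewrite !ord1 !mxE; apply: eq_bigr => k _.
  rewrite !mxE mcoeff_zpart mdeg0 (res_aug_homog nz).
  have [->|/res_aug_homog->] := eqVneq (res_aug G k 0) 0.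
    by rewrite !mulr0.
  by rewrite subrr eqxx.
exists (\matrix_i w i); split=> [i k|]; first by rewrite mxE.
by apply/row_matrixP => i; rewrite row_mul -map_row rowK ew.
Qed.

Definition preserves_cycles F G m (phi : 'M[S]_(res_rk F m, res_rk G m)) :=
  forall v, aug_cycle v -> aug_cycle (v *m phi).

Lemma lift_aug_cycles F G : exists2 phi : 'M[S]_(res_rk F 0, res_rk G 0),
  mx_homog (@res_deg _ _ F 0) (@res_deg _ _ G 0) phi &
  map_mx (mcoeff 0%MM) phi *m res_aug G = res_aug F /\ preserves_cycles phi.
Proof.
have [phi [hphi ephi]] := lift_aug F G; exists phi => //; split=> // v.
by rewrite /= map_mxM -mulmxA ephi.
Qed.

Lemma lift_step F G m (phi : 'M[S]_(res_rk F m, res_rk G m)) :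
  mx_homog (@res_deg _ _ F m) (@res_deg _ _ G m) phi -> preserves_cycles phi ->
  exists2 phi' : 'M[S]_(res_rk F m.+1, res_rk G m.+1),
    mx_homog (@res_deg _ _ F m.+1) (@res_deg _ _ G m.+1) phi' &
    res_d F m *m phi = phi' *m res_d G m /\ preserves_cycles phi'.
Proof.
move=> hphi cphi.
have [i|phi' hphi' e] := homog_lift (mx_homogM (@res_d_homog _ _ F m) hphi).
  by rewrite row_mul; apply/cphi/res_d_cycle.
exists phi' => //; split=> // v /= v0.
by rewrite -mulmxA -e mulmxA v0 mul0mx.
Qed.

(** On tensor cycles one of the two terms of the usual homotopy between the identity and
    [phi *m psi] vanishes, so a single matrix [h] suffices and the induction can proceed one degree
    at a time. *)
Lemma comparison F G m :
  exists (phi : 'M[S]_(res_rk F m, res_rk G m))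
         (psi : 'M[S]_(res_rk G m, res_rk F m))
         (h : 'M[S]_(res_rk F m, res_rk F m.+1)),
    [/\ mx_homog (@res_deg _ _ F m) (@res_deg _ _ G m) phi,
        mx_homog (@res_deg _ _ G m) (@res_deg _ _ F m) psi &
        mx_homog (@res_deg _ _ F m) (@res_deg _ _ F m.+1) h] /\
    [/\ preserves_cycles phi, preserves_cycles psi &
        forall v, tensor_cycle v ->
          v = v *m phi *m psi + v *m h *m res_d F m].
Proof.
elim: m => [|m [phi [psi [h [[hphi hpsi hh] [cphi cpsi eh]]]]]].
  have [phi hphi [ephi cphi]] := lift_aug_cycles F G.
  have [psi hpsi [epsi cpsi]] := lift_aug_cycles G F.
  have [|i|h hh eh] := @homog_lift F 0 _ (@res_deg _ _ F 0) (1%:M - phi *m psi).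
  - by apply: mx_homogB; [exact: mx_homog1|exact: mx_homogM hpsi].
  - rewrite /= map_row -row_mul raddfB /= map_mxM map_scalar_mx rmorph1.
    by rewrite mulmxBl mul1mx -mulmxA epsi ephi subrr row0.
  exists phi, psi, h; do 2!split=> //; move=> v _.
  by rewrite -!mulmxA -eh mulmxBr mulmx1 addrC mulmxA subrK.
have [phi' hphi' [ephi cphi']] := lift_step hphi cphi.
have [psi' hpsi' [epsi cpsi']] := lift_step hpsi cpsi.
(* The rows of this error term are cycles: the rows of [res_d F m] are tensor cycles, so the
   identity of the induction hypothesis applies to them. *)
have [|i|h' hh' eh'] := @homog_lift F m.+1 _ (@res_deg _ _ F m.+1)
    (1%:M - phi' *m psi' - res_d F m *m h).
- apply: mx_homogB; last exact: mx_homogM (@res_d_homog _ _ F m) hh.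
  by apply: mx_homogB; [exact: mx_homog1|exact: mx_homogM hpsi'].
- rewrite /= -row_mul !mulmxBl mul1mx -mulmxA -epsi mulmxA -ephi.
  have {1}-> : res_d F m = res_d F m *m phi *m psi + res_d F m *m h *m res_d F
    m.
    apply/row_matrixP => k; rewrite raddfD /= !row_mul.
    exact/eh/aug_tensor_cycle/res_d_cycle.
  by rewrite -addrA -opprD subrr row0.
exists phi', psi', h'; do 2!split=> //; move=> v /= v0.
by rewrite -[v *m h' *m _]mulmxA -eh' !mulmxBr !mulmxA v0 mul0mx subr0 mulmx1
  addrC subrK.
Qed.

Definition ideal_like (I : S -> Prop) :=
  [/\ I 0, forall f g, I f -> I g -> I (f + g) & forall f g, I f -> I (f * g)].

Definition tor_neq0_in F (I : S -> Prop) m j :=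
  exists v : 'rV[S]_(res_rk F m),
    [/\ tensor_deg I j v, tensor_cycle v &
        ~ (exists2 w : 'rV[S]_(res_rk F m.+1),
             tensor_deg I j w & v = w *m res_d F m)].

Lemma tensor_degM F G I j m m' (v : 'rV[S]_(res_rk F m))
    (M : 'M[S]_(res_rk F m, res_rk G m')) :
  ideal_like I -> mx_homog (@res_deg _ _ F m) (@res_deg _ _ G m') M ->
  tensor_deg I j v -> tensor_deg I j (v *m M).
Proof.
move=> [I0 ID IM] hM hv k; rewrite mxE; split.
  by elim/big_ind: _ => // i _; apply: IM; case: (hv i).
apply: zhomog_sum => i _.
have -> : j - res_deg k = (j - res_deg i) + (res_deg i - res_deg k).
  by rewrite subrKA.
by apply: zhomogM => //; case: (hv i).
Qed.

Lemma preserves_tensor_cycles F G m (phi : 'M[S]_(res_rk F m, res_rk G m)) v :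
  preserves_cycles phi -> tensor_cycle v -> tensor_cycle (v *m phi).
Proof. by case: m phi v => // m phi v h /h. Qed.

(** If [v *m phi] were the boundary of some [w], transporting [w] back along a lift of [psi] and
    adding [v *m h] would bound [v]. *)
Lemma tor_neq0_indep F G I m j : ideal_like I ->
  tor_neq0_in F I m j -> tor_neq0_in G I m j.
Proof.
move=> hI [v [dv cv nv]].
have [phi [psi [h [[hphi hpsi hh] [cphi cpsi eh]]]]] := comparison F G m.
exists (v *m phi); split;
  [exact: tensor_degM dv|exact: preserves_tensor_cycles|].
case=> w dw ew; apply: nv.
have [psi' hpsi' [epsi _]] := lift_step hpsi cpsi.
exists (w *m psi' + v *m h);
  last by rewrite {1}(eh _ cv) ew -mulmxA epsi mulmxA mulmxDl.
move=> k; rewrite mxE; have [I0 ID IM] := hI.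
have [? ?] := tensor_degM hI hpsi' dw k.
have [? ?] := tensor_degM hI hh dv k.
by split; [exact: ID|exact: zhomogD].
Qed.

Lemma Tor_neq0E F I m j : ideal_like I -> Tor_neq0 I m j <-> tor_neq0_in F I m
  j.
Proof.
by move=> hI; split=> [[G]|]; [exact: tor_neq0_indep|exists F].
Qed.

End Comparison.

(** * The Koszul complex by multidegree *)

Section SquarefreeMonomials.
Context (n : nat).
Implicit Types (s : {set 'I_n}) (a u : 'X_{1..n}).

Definition set_mnm s : 'X_{1..n} := [multinom (i \in s : nat) | i < n].

Lemma set_mnm0 : set_mnm set0 = 0%MM.
Proof. by apply/mnmP => i; rewrite mnmE inE mnm0E. Qed.

Lemma set_mnmU1 i s : i \notin s -> set_mnm (i |: s) = (set_mnm s + U_(i))%MM.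
Proof.
move=> iNs; apply/mnmP => k; rewrite mnmDE mnm1E !mnmE !inE eq_sym.
by case: eqP => [<-|_]; rewrite ?(negbTE iNs) ?addn0.
Qed.

Lemma mdeg_set_mnm s : mdeg (set_mnm s) = #|s|.
Proof.
rewrite mdegE -sum1_card [RHS]big_mkcond /=; apply: eq_bigr => i _.
by rewrite mnmE; case: (i \in s).
Qed.

Lemma lem_set_mnm s a : reflect {in s, forall i, 0 < a i}%N (set_mnm s <= a)%MM.
Proof.
apply: (iffP mnm_lepP) => h i; last by rewrite mnmE;
  case: (boolP (i \in s)) => // /h.
by move=> iNs; move: (h i); rewrite mnmE iNs.
Qed.

Lemma lem_addE a b u : (a + b <= u)%MM = (a <= u)%MM && (b <= u - a)%MM.
Proof.
apply/mnm_lepP/andP => [h|[/mnm_lepP h1 /mnm_lepP h2] i].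
  split; apply/mnm_lepP => i; move: (h i); rewrite mnmDE ?mnmBE;
    first exact/leq_trans/leq_addr.
  by move=> hi; rewrite leq_subRL // (leq_trans _ hi) // leq_addr.
by move: (h2 i); rewrite mnmDE mnmBE leq_subRL.
Qed.

(* The upper Koszul simplicial complex in degree [a] of the monomial ideal with
   exponent set [U]. *)
Definition koszul_complex (U : 'X_{1..n} -> Prop) a s :=
  (set_mnm s <= a)%MM /\ U (a - set_mnm s)%MM.

End SquarefreeMonomials.

(** * Koszul differential and its multidegree slices *)

Section Koszul.
Context (K : fieldType) (n : nat).
Local Notation S := {mpoly K[n]}.
Local Notation chain := {ffun {set 'I_n} -> K}.
Implicit Types (a u : 'X_{1..n}) (U : 'X_{1..n} -> Prop) (s : {set 'I_n}) (m :
  nat).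

Definition koszul_rk m := #|[set s : {set 'I_n} | #|s| == m]|.

Definition face m (i : 'I_(koszul_rk m)) : {set 'I_n} := enum_val i.

Lemma card_face m (i : 'I_(koszul_rk m)) : #|face i| = m.
Proof. by have := enum_valP i; rewrite inE => /eqP. Qed.

Lemma face_inj m : injective (@face m).
Proof. exact: enum_val_inj. Qed.

Lemma faceP m s : #|s| = m -> exists i : 'I_(koszul_rk m), face i = s.
Proof.
move=> sm; have h : s \in [set s : {set 'I_n} | #|s| == m] by rewrite inE sm.
by exists (enum_rank_in h s); rewrite /face enum_rankK_in.
Qed.

(** At most one [l] meets the condition. The sum avoids choosing it and is 0 when [face k] is not
    contained in [face i]. *)
Definition koszul_d m : 'M[S]_(koszul_rk m.+1, koszul_rk m) :=
  \matrix_(i, k) \sum_(l | (l \notin face k) && (face i == l |: face k))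
     (face_sign K l (face k))%:MP * 'X_l.

(* The multidegree-[a] part of a vector, as a simplicial chain. *)
Definition slice a m (v : 'rV[S]_(koszul_rk m)) : chain :=
  [ffun s : {set 'I_n} => \sum_(i | face i == s)
     (if (set_mnm s <= a)%MM then (v 0 i)@_(a - set_mnm s) else 0)].

Lemma slice_face a m (v : 'rV[S]_(koszul_rk m)) i :
  slice a v (face i) =
    if (set_mnm (face i) <= a)%MM then (v 0 i)@_(a - set_mnm (face i)) else 0.
Proof.
by rewrite ffunE (big_pred1 i) // => k; rewrite (inj_eq (@face_inj m)).
Qed.

Lemma slice_neq0 a m (v : 'rV[S]_(koszul_rk m)) s : slice a v s != 0 ->
  exists i, [/\ face i = s, (set_mnm s <= a)%MM & (v 0 i)@_(a - set_mnm s) !=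
    0].
Proof.
have [sm|sm] := eqVneq #|s| m; last first.
  rewrite ffunE big1 ?eqxx // => i /eqP es.
  by move: sm; rewrite -es card_face eqxx.
have [i <-] := faceP sm; rewrite slice_face.
by case: ifP => [le nz|_]; [exists i|rewrite eqxx].
Qed.

(** The coefficient of exponent [u] at a face is visible in the multidegree [u] plus the exponent of
    that face. *)
Lemma slice_inj m (v w : 'rV[S]_(koszul_rk m)) :
  (forall a, slice a v = slice a w) -> v = w.
Proof.
move=> h; apply/rowP => i; apply/mpolyP => u.
have := congr1 (fun c : chain => c (face i)) (h (u + set_mnm (face i))%MM).
by rewrite !slice_face lem_addl addmK.
Qed.

Lemma mcoeffMU (f : S) l u :
  (f * 'X_l)@_u = if (U_(l) <= u)%MM then f@_(u - U_(l)) else 0.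
Proof.
case: ifPn => [le|nle]; first by rewrite -{1}(submK le) addmC mcoeffMX.
apply/eqP; apply: contraNT nle => /mcoeffM_neq0[u1 [u2 [-> _]]].
rewrite mcoeffX; have [<-|] := eqVneq U_(l)%MM u2; first by rewrite lem_addl.
by rewrite eqxx.
Qed.

(** Removing [l] from a face multiplies the coefficient by ['X_l], so the multidegree is unchanged
    and only the simplicial sign remains. *)
Lemma slice_d a m (v : 'rV[S]_(koszul_rk m.+1)) :
  slice a (v *m koszul_d m) = bd (slice a v).
Proof.
apply/ffunP => s; rewrite bdE.
have [sm|sm] := eqVneq #|s| m; last first.
  rewrite big1 => [|l ls].
    by apply/eqP; apply: contraNT sm => /slice_neq0[i [<-]]; rewrite card_face.
  have [->|/slice_neq0[i [es]]] := eqVneq (slice a v (l |: s)) 0.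
    by rewrite mulr0.
  by move: (card_face i); rewrite es cardsU1 ls => -[]; move/eqP: sm.
have [k <-] := faceP sm; rewrite slice_face mxE.
under [RHS]eq_bigr => l lk.
  rewrite ffunE mulr_sumr set_mnmU1 // lem_addE -submDA.
  over.
rewrite (exchange_big_dep predT) //=.
case: ifP => le; last first.
  by rewrite big1 // => i _; rewrite big1 // => l _; rewrite mulr0.
rewrite raddf_sum; apply: eq_bigr => i _; rewrite !mxE mulr_sumr raddf_sum /=.
apply: eq_bigr => l _.
by rewrite mulrCA mul_mpolyC mcoeffZ mcoeffMU.
Qed.

(** This inverts slicing for a family supported in total degrees below [N]; the bound keeps every
    entry a finite sum. *)
Definition unslice (N m : nat) (W : 'X_{1..n} -> chain) : 'rV[S]_(koszul_rk m)
  :=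
  \row_i \sum_(a : 'X_{1..n < N} | (set_mnm (face i) <= a)%MM)
     W a (face i) *: 'X_[a - set_mnm (face i)].

Lemma slice_unslice a N m (W : 'X_{1..n} -> chain) :
  (forall b, carried (fun s => (set_mnm s <= b)%MM) m (W b)) ->
  (W a != 0 -> (mdeg a < N)%N) -> slice a (unslice N m W) = W a.
Proof.
move=> hW aN; apply/ffunP => s.
have [sm|sm] := eqVneq #|s| m; last first.
  transitivity (0 : K); apply/eqP; [|rewrite eq_sym]; apply: contraNT sm.
    by move=> /slice_neq0[i [<-]]; rewrite card_face.
  by move=> /hW[_ ->].
have [i <-] := faceP sm; rewrite slice_face mxE raddf_sum /=.
case: ifPn => [le|nle]; last first.
  by apply/eqP; rewrite eq_sym; apply: contraNT nle => /hW[].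
have [{}aN|Na] := ltnP (mdeg a) N.
  rewrite (bigD1 (BMultinom aN)) //= mcoeffZ mcoeffX eqxx mulr1 big1 ?addr0 //.
  move=> b /andP[bi ba]; rewrite mcoeffZ mcoeffX; case: eqP => [e|];
    last by rewrite mulr0.
  by case/eqP: ba; apply/val_inj; rewrite /= -(submK bi) e submK.
have -> : W a = 0 by apply: contraTeq Na => /aN; rewrite -ltnNge.
rewrite ffunE big1 // => b bi; rewrite mcoeffZ mcoeffX; case: eqP => [e|];
  last by rewrite mulr0.
by move: Na; rewrite -(submK le) -e submK // leqNgt bmdeg.
Qed.

Lemma slice_bounded m (v : 'rV[S]_(koszul_rk m)) :
  exists N, forall a, slice a v != 0 -> (mdeg a < N)%N.
Proof.
exists (\max_i msize (v ord0 i) + m)%N => a nz.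
have [s] : exists s, slice a v s != 0.
  apply/existsP; apply: contraNT nz; rewrite negb_exists => /forallP h.
  by apply/eqP/ffunP => s; rewrite [RHS]ffunE; apply/eqP; move: (h s);
    rewrite negbK.
move=> /slice_neq0[i [<- le]]; rewrite -mcoeff_msupp => /msize_mdeg_lt.
rewrite -{2}(submK le) mdegD mdeg_set_mnm card_face ltn_add2r => h.
apply: leq_trans h _; exact: (leq_bigmax i).
Qed.

(** Bounding chains are chosen independently in each multidegree and then reassembled by
    [unslice]. *)
Lemma slice_boundary U m (v : 'rV[S]_(koszul_rk m)) :
  (forall a, exists2 b, carried (koszul_complex U a) m.+1 b & bd b = slice a v)
    ->
  exists w : 'rV[S]_(koszul_rk m.+1), [/\ v = w *m koszul_d m,
    forall a, carried (koszul_complex U a) m.+1 (slice a w) &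
    forall a, slice a v = 0 -> slice a w = 0].
Proof.
move=> h.
(* Taking the zero chain wherever the slice is zero leaves only finitely many nonzero choices. *)
have {}h a : exists b : chain, [/\ carried (koszul_complex U a) m.+1 b,
    bd b = slice a v & slice a v = 0 -> b = 0].
  have [b hb eb] := h a; have [z|/eqP nz] := eqVneq (slice a v) 0;
    last by exists b.
  by exists 0; rewrite raddf0 z; split=> // s; rewrite ffunE eqxx.
have [W hW] : exists W : 'X_{1..n} -> chain, forall a,
    [/\ carried (koszul_complex U a) m.+1 (W a), bd (W a) = slice a v &
        slice a v = 0 -> W a = 0].
  exists (fun a => proj1_sig (constructive_indefinite_description _ (h a))) =>
    a.
  exact: (proj2_sig (constructive_indefinite_description _ (h a))).
have [N hN] := slice_bounded v.
have eW a : slice a (unslice N m.+1 W) = W a.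
  apply: slice_unslice => [b s|].
    by case: (hW b) => cW _ _ /cW[[]].
  case: (hW a) => _ _ Wz nz; apply: hN; apply: contraNneq nz => /Wz ->.
  exact: eqxx.
exists (unslice N m.+1 W); split=> [|a|a]; rewrite ?eW; try by case: (hW a).
by apply: slice_inj => a; rewrite slice_d eW; case: (hW a).
Qed.

Lemma slice0 m (v : 'rV[S]_(koszul_rk m.+1)) : slice 0%MM v = 0.
Proof.
apply/ffunP => s; rewrite [RHS]ffunE; apply/eqP.
apply: contraT => /slice_neq0[i [<- /lem_set_mnm h _]].
have /set0Pn[k /h] : face i != set0 by rewrite -card_gt0 card_face.
by rewrite mnm0E.
Qed.

(** In a nonzero multidegree the squarefree divisors form a cone over any variable that occurs, so
    every cycle bounds. Multidegree 0 is covered by the second hypothesis. *)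
Lemma koszul_exact m (v : 'rV[S]_(koszul_rk m)) :
  (forall a, bd (slice a v) = 0) -> slice 0%MM v = 0 ->
  exists w, v = w *m koszul_d m.
Proof.
move=> hv v0; have [a|w [-> _ _]] := @slice_boundary (fun _ => True) m v;
  last by exists w.
have [->|/eqP a0] := eqVneq a 0%MM.
  by exists 0; rewrite ?raddf0 // => s; rewrite ffunE eqxx.
have [k ak] : exists k, a k != 0%N.
  apply/existsP; apply: contraT; rewrite negb_exists => /forallP h; case: a0.
  by apply/mnmP => i; rewrite mnm0E; apply/eqP; move: (h i); rewrite negbK.
apply: (cone_boundary (k := k)) (hv a) => [s [/lem_set_mnm h _]|s].
  split=> //; apply/lem_set_mnm => i; rewrite !inE => /orP[/eqP->|/h//].
  by rewrite lt0n.
by move=> /slice_neq0[i [<- h _]]; rewrite card_face; do 2!split.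
Qed.

End Koszul.

(** * The Koszul resolution *)

Section KoszulResolution.
Context (K : fieldType) (n : nat).
Local Notation S := {mpoly K[n]}.
Local Notation koszul_rk := (koszul_rk n).
Local Notation koszul_d := (koszul_d K n).
Local Notation face := (@face n).

Definition koszul_deg m (i : 'I_(koszul_rk m)) : int := m%:Z.

Lemma koszul_d_homog m i k :
  zhomog (@koszul_deg m.+1 i - @koszul_deg m k) (koszul_d m i k).
Proof.
have -> : koszul_deg i - koszul_deg k = 1 by rewrite /koszul_deg intS addrK.
rewrite mxE.
apply: zhomog_sum => l _; rewrite mul_mpolyC; apply/dhomogZ.
by rewrite dhomogX; apply/eqP/mdeg1.
Qed.

Lemma face0 (i : 'I_(koszul_rk 0)) : face i = set0.
Proof. by apply/eqP; rewrite -cards_eq0 card_face. Qed.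

Definition koszul_aug : 'cV[K]_(koszul_rk 0) := const_mx 1.

Lemma koszul_augE (v : 'rV[S]_(koszul_rk 0)) i j k :
  (map_mx (mcoeff 0%MM) v *m koszul_aug) i j = (v 0 k)@_0%MM.
Proof.
rewrite !ord1 mxE (big_pred1 k) => [|l]; first by rewrite !mxE mulr1.
by apply/esym/eqP/(@face_inj n); rewrite !face0.
Qed.

Lemma koszul_rk0 : 'I_(koszul_rk 0).
Proof.
have h : set0 \in [set s : {set 'I_n} | #|s| == 0%N] by rewrite inE cards0.
exact: enum_rank_in h set0.
Qed.

Lemma koszul_aug_homog (i : 'I_(koszul_rk 0)) :
  koszul_aug i 0 != 0 -> koszul_deg i = 0.
Proof. by []. Qed.

Lemma koszul_aug_surj (c : 'M[K]_1) :
  exists v : 'rV[S]_(koszul_rk 0), map_mx (mcoeff 0%MM) v *m koszul_aug = c.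
Proof.
exists (const_mx (c 0 0)%:MP); apply/matrixP => i j.
by rewrite (koszul_augE _ _ _ koszul_rk0) mxE mcoeffC eqxx mulr1 !ord1.
Qed.

Lemma slice0_aug (v : 'rV[S]_(koszul_rk 0)) :
  slice 0%MM v = 0 <-> map_mx (mcoeff 0%MM) v *m koszul_aug = 0.
Proof.
have e : slice 0%MM v (face koszul_rk0) = (v 0 koszul_rk0)@_0%MM.
  by rewrite slice_face face0 set_mnm0 lepm_refl subm0.
split=> h.
  apply/matrixP => i j.
  by rewrite (koszul_augE _ _ _ koszul_rk0) mxE -e h ffunE.
apply/ffunP => s; rewrite [RHS]ffunE; apply/eqP; apply: contraT.
move=> /[dup] nz /slice_neq0[i [es _ _]]; move: nz.
rewrite -es face0 -(face0 koszul_rk0) e.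
by rewrite -(koszul_augE v 0 0) h mxE eqxx.
Qed.

Lemma koszul_exact0 (v : 'rV[S]_(koszul_rk 0)) :
  map_mx (mcoeff 0%MM) v *m koszul_aug = 0 <-> exists w, v = w *m koszul_d 0.
Proof.
split=> [/slice0_aug v0|[w ->]].
  apply: koszul_exact => // a; apply: bd_card0 => s.
  by move=> /slice_neq0[i [<- _ _]]; rewrite card_face.
by apply/slice0_aug; rewrite slice_d slice0 raddf0.
Qed.

Lemma slice_zero m a : slice a (0 : 'rV[S]_(koszul_rk m)) = 0.
Proof.
apply/ffunP => s; rewrite [RHS]ffunE; apply/eqP; apply: contraT.
by move=> /slice_neq0[i [_ _]]; rewrite mxE mcoeff0 eqxx.
Qed.

Lemma koszul_exactS m (v : 'rV[S]_(koszul_rk m.+1)) :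
  v *m koszul_d m = 0 <-> exists w, v = w *m koszul_d m.+1.
Proof.
split=> [v0|[w ->]].
  by apply: koszul_exact => [a|];
    [rewrite -slice_d v0 slice_zero|exact: slice0].
by apply: slice_inj => a; rewrite slice_zero !slice_d bdK.
Qed.

Definition koszul : graded_resolution K n :=
  GradedResolution koszul_d_homog koszul_aug_homog koszul_aug_surj
    koszul_exact0 koszul_exactS.

Lemma koszul_cycleP m (v : 'rV[S]_(koszul_rk m)) :
  @tensor_cycle _ _ koszul m v <-> forall a, bd (slice a v) = 0.
Proof.
case: m v => [|m] v; split=> //= h.
- by move=> a; apply: bd_card0 => s /slice_neq0[i [<- _ _]]; rewrite card_face.
- by move=> a; rewrite -slice_d h slice_zero.
- by apply: slice_inj => a; rewrite slice_d h slice_zero.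
Qed.

(** Exponent sets replace generators, so that the ideal, its colon by a variable and its sum with a
    variable are handled uniformly, the unit ideal included. *)
Definition monomial_span (U : 'X_{1..n} -> Prop) (I : S -> Prop) :=
  (forall a b, U a -> (a <= b)%MM -> U b) /\
  (forall f, I f <-> forall u, f@_u != 0 -> U u).

Lemma monomial_span_ideal U I : monomial_span U I -> ideal_like I.
Proof.
case=> upU hI; split.
- by apply/hI => u; rewrite mcoeff0 eqxx.
- move=> f g /hI hf /hI hg; apply/hI => u; rewrite mcoeffD.
  by have [->|/hf//] := eqVneq f@_u 0; rewrite add0r => /hg.
- move=> f g /hI hf; apply/hI => u /mcoeffM_neq0[u1 [u2 [-> /hf h _]]].
  by apply: upU h _; apply: lem_addr.
Qed.

Lemma tensor_deg_slice U I m j (v : 'rV[S]_(koszul_rk m)) : monomial_span U I ->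
  @tensor_deg _ _ koszul I m j v <->
  forall a, carried (koszul_complex U a) m (slice a v) /\
            (slice a v != 0 -> (mdeg a)%:Z = j).
Proof.
case=> upU hI; split=> [dv a|h i].
  split=> [s /slice_neq0[i [<- le nz]]|].
    rewrite card_face; do 2!split=> //.
    by case: (dv i) => /hI/(_ _ nz).
  move=> nz; have [s] : exists s, slice a v s != 0.
    apply/existsP; apply: contraNT nz; rewrite negb_exists => /forallP h.
    by apply/eqP/ffunP => s; rewrite [RHS]ffunE; apply/eqP; move: (h s);
      rewrite negbK.
  move=> /slice_neq0[i [<- le nzi]]; have [_ /zhomogP/(_ _ nzi) e] := dv i.
  by rewrite -(submK le) mdegD PoszD mdeg_set_mnm card_face e subrK.
have key u : (v 0 i)@_u != 0 ->
    slice (u + set_mnm (face i))%MM v (face i) != 0.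
  by rewrite slice_face lem_addl addmK.
split.
  apply/hI => u /key nz; have [/(_ _ nz)[[_]]] := h (u + set_mnm (face i))%MM.
  by rewrite addmK.
apply/zhomogP => u /key nz; have [_ <-] := h (u + set_mnm (face i))%MM.
  by rewrite mdegD PoszD mdeg_set_mnm card_face addrK.
by apply: contraNneq nz => ->; rewrite ffunE.
Qed.

(** The Koszul complex is the direct sum of its multidegrees. If no multidegree of total degree [j]
    had homology, [slice_boundary] would glue bounding chains of the slices into one for [v].
    Conversely, a nonzero class at one [a] gives a vector whose only nonzero slice is at [a]. *)
Lemma Tor_neq0P U I m j : monomial_span U I ->
  Tor_neq0 I m j <->
  exists2 a, (mdeg a)%:Z = j & hom_neq0 K (koszul_complex U a) m.
Proof.
move=> hU; rewrite (Tor_neq0E koszul _ _ (monomial_span_ideal hU)).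
split=> [[v [/(tensor_deg_slice _ _ hU) dv cv nv]]|[a ja [c [hc bc nc]]]].
  apply: NNPP => none; apply: nv.
  have [a|w [ew cw w0]] := @slice_boundary K n U m v; last first.
    exists w => //; apply/(tensor_deg_slice _ _ hU) => a; split=> // nz.
    by apply: (dv a).2; apply: contraNneq nz => /w0->.
  have [->|nz] := eqVneq (slice a v) 0.
    by exists 0; rewrite ?raddf0 // => s; rewrite ffunE eqxx.
  have [ca /(_ nz) da] := dv a.
  apply: NNPP => nb; apply: none; exists a => //; exists (slice a v);
    split=> //.
  exact: (koszul_cycleP v).1 cv a.
pose W b : {ffun {set 'I_n} -> K} := if b == a then c else 0.
have eW b : slice b (unslice (mdeg a).+1 m W) = W b.
  apply: slice_unslice => [b' s|]; rewrite /W; last first.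
    by have [->|_] := eqVneq b a; rewrite ?eqxx.
  by have [->|_] := eqVneq b' a => [/hc[[]]//|]; rewrite ffunE eqxx.
exists (unslice (mdeg a).+1 m W); split.
- apply/(tensor_deg_slice _ _ hU) => b; rewrite eW /W.
  have [->|_] := eqVneq b a; first by split.
  by split=> [s|]; rewrite ?ffunE eqxx.
- apply/koszul_cycleP => b; rewrite eW /W.
  by case: eqP => _; rewrite ?raddf0.
- case=> w /(tensor_deg_slice _ _ hU) dw ew; apply: nc.
  exists (slice a w); first by case: (dw a).
  by rewrite -slice_d -[w *m _]ew eW /W eqxx.
Qed.

End KoszulResolution.

(** * Monomial ideals and finiteness of the regularity *)

Section MonomialIdeals.
Context (K : fieldType) (n : nat).
Local Notation S := {mpoly K[n]}.
Implicit Types (I : S -> Prop) (U : 'X_{1..n} -> Prop).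

Lemma span_sum_ind (A : S -> Prop) f : A 0 ->
  (forall g h, A g -> A h -> A (g + h)) ->
  (forall u, f@_u != 0 -> A (f@_u *: 'X_[u])) -> A f.
Proof.
move=> A0 AD h; rewrite [f]mpolyE big_seq; elim/big_ind: _ => // u.
by rewrite mcoeff_msupp => /h.
Qed.

Lemma monomial_ideal_span I :
  monomial_ideal I -> monomial_span (fun a => I 'X_[a]) I.
Proof.
case=> G hG.
have supp f u : I f -> f@_u != 0 -> exists2 m, G m & (m <= u)%MM.
  move=> /hG[s [hs ->]]; rewrite big_seq; move: u.
  elim/big_ind: _ => [u|g h hg hh u|q /hs[m Gm ->] u].
  - by rewrite mcoeff0 eqxx.
  - by rewrite mcoeffD; have [->|/hg//] := eqVneq g@_u 0; rewrite add0r => /hh.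
  - move=> /mcoeffM_neq0[u1 [u2 [-> _]]]; rewrite -mcoeff_msupp.
    by move=> /mem_msuppXP <-; exists m => //; apply: lem_addl.
have gen c m u : G m -> (m <= u)%MM -> I (c *: 'X_[u]).
  move=> Gm le; apply/hG; exists [:: (c *: 'X_[(u - m)%MM], 'X_[m])]; split.
    by move=> q; rewrite inE => /eqP ->; exists m.
  by rewrite big_seq1 /= -scalerAl -mpolyXD submK.
have suppX u : I 'X_[u] -> exists2 m, G m & (m <= u)%MM.
  by move=> h; apply: supp h _; rewrite mcoeffX eqxx oner_neq0.
split=> [a b /suppX[m Gm ma] ab|f].
  by rewrite -[X in I X]scale1r; apply: gen Gm (lepm_trans ma ab).
split=> [If u /(supp _ _ If)[m Gm mu]|h].
  by rewrite -[X in I X]scale1r; apply: gen Gm mu.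
apply: span_sum_ind => [|g1 g2|u /h/suppX[m Gm mu]]; last exact: gen Gm mu.
  by apply/hG; exists [::]; rewrite big_nil.
move=> /hG[s1 [h1 ->]] /hG[s2 [h2 ->]]; apply/hG; exists (s1 ++ s2).
by rewrite big_cat; split=> // q; rewrite mem_cat => /orP[/h1|/h2].
Qed.

Lemma colon_span U I (x : 'I_n) : monomial_span U I ->
  monomial_span (fun a => U (a + U_(x))%MM) (ideal_colon I 'X_x).
Proof.
case=> upU hI; split=> [a b Ua /mnm_lepP ab|f].
  by apply: upU Ua _; apply/mnm_lepP => i; rewrite !mnmDE leq_add2r.
rewrite /ideal_colon hI mulrC; split=> h u.
  by move=> nz; apply: h; rewrite mcoeffMU lem_addl addmK.
move=> /mcoeffM_neq0[u1 [u2 [-> /h h1]]]; rewrite -mcoeff_msupp.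
by move=> /mem_msuppXP <-.
Qed.

Lemma add_span U I (x : 'I_n) : monomial_span U I ->
  monomial_span (fun a => U a \/ (0 < a x)%N) (ideal_add I 'X_x).
Proof.
move=> /[dup] /monomial_span_ideal[I0 ID IM] [upU hI]; split=> [a b|f].
  move=> [Ua ab|ax /mnm_lepP/(_ x) ab]; [left; exact: upU ab|right].
  exact: leq_trans ab.
split=> [[g [h [Ig ->]] u]|hf].
  rewrite mcoeffD; have [->|/((hI g).1 Ig)] := eqVneq g@_u 0; last by left.
  rewrite add0r => /mcoeffM_neq0[u1 [u2 [-> _]]]; rewrite -mcoeff_msupp.
  by move=> /mem_msuppXP <-; right; rewrite mnmDE mnm1E eqxx addn1.
apply: span_sum_ind => [|_ _ [g1 [h1 [I1 ->]]] [g2 [h2 [I2 ->]]]|u /hf[Uu|ux]].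
- by exists 0, 0; rewrite mul0r addr0.
- by exists (g1 + g2), (h1 + h2); rewrite mulrDl addrACA; split=> //; apply: ID.
- exists (f@_u *: 'X_[u]), 0; rewrite mul0r addr0; split=> //; apply/hI => v.
  rewrite mcoeffZ mcoeffX; have [<-//|_] := eqVneq u v.
  by rewrite mulr0 eqxx.
- exists 0, (f@_u *: 'X_[(u - U_(x))%MM]); rewrite add0r; split=> //.
  by rewrite -scalerAl -mpolyXD submK // lep1mP -lt0n.
Qed.

End MonomialIdeals.

(** * Dickson's lemma *)

Section Dickson.
Context (n : nat).
Implicit Types (a b : 'X_{1..n}) (U : 'X_{1..n} -> Prop) (i k x : 'I_n).

Definition upward U := forall a b, U a -> (a <= b)%MM -> U b.

Definition trunc (d : nat) a : 'X_{1..n} := [multinom minn (a i) d | i < n].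

Lemma mdeg_le a d : (forall i, a i <= d)%N -> (mdeg a <= n * d)%N.
Proof.
by move=> h; rewrite mdegE -[n in (n * d)%N]card_ord -sum_nat_const leq_sum.
Qed.

Lemma ex_uniform (T : finType) (P : T -> nat -> Prop) :
  (forall z s t, P z s -> (s <= t)%N -> P z t) ->
  (forall z, exists t, P z t) -> exists t, forall z, P z t.
Proof.
move=> mono /fin_all_exists[f hf]; exists (\max_z f z) => z.
by apply: mono (hf z) _; apply: leq_bigmax.
Qed.

(** Induction on the number [k] of variables allowed to occur. The slices [Ut t] at exponent [t] of
    the last variable increase with [t]. From some [t0] on they agree with their union on the
    finitely many relevant exponents, and the slices below [t0] are treated separately. *)
Lemma dickson_aux (k : nat) U : upward U -> exists d, forall a,
  (forall i, (k <= i)%N -> a i = 0%N) -> U a -> U (trunc d a).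
Proof.
elim: k U => [|k IHk] U upU.
  by exists 0%N => a a0 Ua; apply: upU Ua _; apply/mnm_lepP => i; rewrite a0.
have [nk|kn] := leqP n k.
  have [d hd] := IHk U upU; exists d => a a0; apply: hd => i ki.
  by have := ltn_ord i; rewrite ltnNge (leq_trans nk ki).
pose x := Ordinal kn.
pose Ut t a := U (a + U_(x) *+ t)%MM.
have upUt t : upward (Ut t).
  move=> a b Ua /mnm_lepP ab; apply: upU Ua _; apply/mnm_lepP => i.
  by rewrite !mnmDE leq_add2r.
have monoU a s t : Ut s a -> (s <= t)%N -> Ut t a.
  move=> Ua st; apply: upU Ua _; apply/mnm_lepP => i.
  by rewrite !mnmDE !mulmnE leq_add2l leq_mul2l st orbT.
have [a b [t Ua] ab|d hd] := IHk (fun a => exists t, Ut t a).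
  by exists t; apply: upUt Ua ab.
(* Exponents truncated at [d] have degree at most [n * d], so a single [t0] serves all of them. *)
have [t0 ht0] : exists t0, forall b : 'X_{1..n < (n * d).+1},
    (exists t, Ut t b) -> Ut t0 b.
  apply: (@ex_uniform 'X_{1..n < (n * d).+1}
    (fun z t => (exists s, Ut s z) -> Ut t z)).
    by move=> b s t h st /h/monoU; apply.
  move=> b; have [[t ht]|no] := classic (exists t, Ut t b); first by exists t.
  by exists 0%N => /no.
have [d' hd'] : exists d', forall t : 'I_t0, forall a,
    (forall i, (k <= i)%N -> a i = 0%N) -> Ut t a -> Ut t (trunc d' a).
  apply: (@ex_uniform _ (fun (t : 'I_t0) d' => forall a,
    (forall i, (k <= i)%N -> a i = 0%N) -> Ut t a -> Ut t (trunc d' a))).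
    move=> t s s' h ss a a0 /(h _ a0) Ua; apply: upUt Ua _.
    by apply/mnm_lepP => i; rewrite !mnmE; lia.
  by move=> t; apply: IHk.
(* The sum dominates [d] for the union, [d'] for the slices below [t0], and [t0] for the exponent of
   the last variable. *)
exists (d + d' + t0)%N => a a0 Ua.
pose a' : 'X_{1..n} := [multinom if i == x then 0%N else a i | i < n].
have a'0 i : (k <= i)%N -> a' i = 0%N.
  rewrite mnmE; case: eqP => // ix ki; apply: a0; rewrite ltn_neqAle ki andbT.
  by apply/eqP => e; apply: ix; apply/val_inj.
have Ua' : Ut (a x) a'.
  apply: upU Ua _; apply/mnm_lepP => i; rewrite mnmDE mulmnE mnm1E mnmE.
  by rewrite eq_sym; case: eqP => [->|_]; lia.
have [lt|ge] := ltnP (a x) t0.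
  apply: upU (hd' (Ordinal lt) _ a'0 Ua') _; apply/mnm_lepP => i.
  rewrite mnmDE mulmnE mnm1E !mnmE eq_sym /=.
  by case: eqP => [<-|_] /=; lia.
have ha : (mdeg (trunc d a') < (n * d).+1)%N.
  by rewrite ltnS mdeg_le // => i; rewrite mnmE geq_minr.
have := ht0 (BMultinom ha) (hd _ a'0 (ex_intro (fun t => Ut t a') _ Ua')).
move=> h; apply: upU h _; apply/mnm_lepP => i.
rewrite mnmDE mulmnE mnm1E !mnmE eq_sym /=.
by case: eqP => [<-|_] /=; lia.
Qed.

(** This expresses finite generation without a list of generators: all exponents of the minimal
    elements of [U] are at most [d]. *)
Lemma dickson U : upward U -> exists d, forall a, U a -> U (trunc d a).
Proof.
move=> /(dickson_aux n)[d hd]; exists d => a; apply: hd => i.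
by rewrite leqNgt ltn_ord.
Qed.

Lemma ex_minimal U a : U a ->
  exists2 b, U b & forall c, U c -> (c <= b)%MM -> c = b.
Proof.
have [k] := ubnP (mdeg a); elim: k a => // k IH a ak Ua.
have [[c [Uc [ca nca]]]|no] :=
  classic (exists c, U c /\ (c <= a)%MM /\ c <> a); last first.
  by exists a => // c Uc ca; apply: NNPP => ne; apply: no; exists c.
apply: (IH c) Uc; apply: (@leq_trans (mdeg a)); last by rewrite -ltnS.
have e := submK ca; rewrite -e mdegD -[X in (X < _)%N]add0n ltn_add2r.
rewrite lt0n mdeg_eq0; apply/eqP => z; apply: nca.
by rewrite -e z add0m.
Qed.

End Dickson.

(** * Bounds on Koszul homology and existence of the regularity *)

Section KoszulHomology.
Context (K : fieldType) (n : nat).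
Implicit Types (a b : 'X_{1..n}) (U : 'X_{1..n} -> Prop) (s : {set 'I_n}).
Local Notation hom U a m := (hom_neq0 K (koszul_complex U a) m).

(** A nonempty face would give a strictly smaller element of [U]. Hence the complex is the empty
    face alone, whose class cannot bound. *)
Lemma hom_minimal U a : U a -> (forall b, U b -> (b <= a)%MM -> b = a) ->
  hom U a 0.
Proof.
move=> Ua mina; exists [ffun s => (s == set0)%:R]; split.
- move=> s; rewrite ffunE; have [->|] := eqVneq s set0; last by rewrite eqxx.
  rewrite cards0 /koszul_complex set_mnm0 subm0; split=> //; split=> //.
  by apply/mnm_lepP => i; rewrite mnm0E.
- apply: bd_card0 => s; rewrite ffunE; have [->|] := eqVneq s set0.
    by rewrite cards0.
  by rewrite eqxx.
- case=> b hb /(congr1 (fun c : {ffun {set 'I_n} -> K} => c set0)).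
  rewrite bdE ffunE eqxx big1 => [/esym/eqP|i _]; first by rewrite oner_eq0.
  have [->|] := eqVneq (b (i |: set0)) 0; first by rewrite mulr0.
  move=> /hb[[/mnm_lepP le /mina/(_ (lem_subr _ _)) e]].
  move: (le i) (congr1 (fun c : 'X_{1..n} => c i) e).
  by rewrite mnmBE !mnmE !inE eqxx /=; lia.
Qed.

(** If an exponent [a k] exceeds the bound [d] of [dickson], adding [k] to a face leaves at least
    [d] factors of that variable and does not affect membership in [U]. The complex is then a cone
    over [k]. *)
Lemma hom_bounded U : upward U ->
  exists B, forall a m, hom U a m -> (mdeg a <= B)%N.
Proof.
move=> upU; have [d hd] := dickson upU; exists (n * d)%N => a m h.
apply: mdeg_le => k; rewrite leqNgt; apply/negP => ak; move: h.
apply: (hom_cone (k := k)) => s [/lem_set_mnm le Us].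
have le' : {in k |: s, forall i, 0 < a i}%N.
  by move=> i; rewrite !inE => /orP[/eqP->|/le//]; apply: leq_ltn_trans ak.
split; first exact/lem_set_mnm.
apply: upU (hd _ Us) _; apply/mnm_lepP => i; rewrite !mnmE !inE.
have [->|_] := eqVneq i k => /=; last by rewrite geq_minl.
by rewrite geq_min; apply/orP; right; lia.
Qed.

Lemma int_max (P : int -> Prop) (B x : int) : P x -> (forall y, P y -> y <= B)
  ->
  exists r, P r /\ forall y, P y -> y <= r.
Proof.
move=> Px hB; have [k] := ubnP `|B - x|%N.
elim: k x Px => // k IH x Px kx.
have [[y [Py xy]]|no] := classic (exists y, P y /\ x < y).
  by apply: (IH y Py); have := hB _ Py; lia.
exists x; split=> // y Py; rewrite leNgt; apply/negP => xy.
by apply: no; exists y.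
Qed.

(** A minimal element of [U] supplies one value and [hom_bounded] bounds all values, so a maximum
    exists and [epsilon] returns it rather than an arbitrary integer. *)
Lemma reg_spec U (I : {mpoly K[n]} -> Prop) a0 : monomial_span U I -> U a0 ->
  (exists a m, hom U a m /\ reg I = (mdeg a)%:Z - m%:Z) /\
  (forall a m, hom U a m -> (mdeg a)%:Z - m%:Z <= reg I).
Proof.
move=> hI U0; have [upU _] := hI.
have [B hB] := hom_bounded upU.
have [b Ub minb] := ex_minimal U0.
have ex : exists r, is_reg I r.
  have [|y|r [Pr hr]] := @int_max (fun r => exists m j, Tor_neq0 I m j /\ r = j
    - m%:Z)
     B%:Z ((mdeg b)%:Z - 0%:Z).
  - exists 0%N, (mdeg b)%:Z; split=> //; apply/(Tor_neq0P _ _ hI).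
    by exists b => //; apply: hom_minimal.
  - move=> [m [j [/(Tor_neq0P _ _ hI)[a <- /hB h] ->]]]; lia.
  by exists r; split=> // m j h; apply: hr; exists m, j.
have [[m [j [/(Tor_neq0P _ _ hI)[a ja h] e]]] le] := epsilon_spec (inhabits 0)
  (is_reg I) ex.
split; first by exists a, m; rewrite ja.
by move=> a' m' h'; apply: le; apply/(Tor_neq0P _ _ hI); exists a'.
Qed.

Lemma koszul_down U a i s : upward U -> i \notin s ->
  koszul_complex U a (i |: s) -> koszul_complex U a s.
Proof.
move=> upU iNs [/lem_set_mnm le Us]; split.
  by apply/lem_set_mnm => k ks; apply: le; rewrite !inE ks orbT.
apply: upU Us _; apply/mnm_lepP => k; rewrite !mnmE !inE.
by case: (k == i) => //=; lia.
Qed.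

End KoszulHomology.

(** * Deletion and link of a variable *)

Section ColonAdd.
Context (K : fieldType) (n : nat) (x : 'I_n) (U : 'X_{1..n} -> Prop).
Hypothesis upU : upward U.
Implicit Types (a b : 'X_{1..n}) (s : {set 'I_n}) (m : nat).
Local Notation hom V a m := (hom_neq0 K (koszul_complex V a) m).
Local Notation Uc := (fun a => U (a + U_(x))%MM).
Local Notation Ua := (fun a => U a \/ (0 < a x)%N).

Lemma upward_add : upward Ua.
Proof.
move=> a b [h ab|ax /mnm_lepP/(_ x)]; first by left; apply: upU ab.
by right; lia.
Qed.

Lemma koszul_add_free a s : a x = 0%N ->
  koszul_complex Ua a s <-> koszul_complex U a s.
Proof.
move=> ax; split=> -[le]; last by move=> h; split=> //; left.
by case=> [//|]; rewrite mnmBE ax.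
Qed.

Lemma koszul_colonE a s : (set_mnm s <= a)%MM ->
  koszul_complex Uc a s <-> koszul_complex U (a + U_(x))%MM s.
Proof.
move=> le; rewrite /koszul_complex.
have -> : (a - set_mnm s + U_(x))%MM = (a + U_(x) - set_mnm s)%MM.
  apply/mnmP => i; rewrite !(mnmDE, mnmBE); move/mnm_lepP/(_ i): le; lia.
by rewrite le (lepm_trans le (lem_addr _ _)).
Qed.

(** Since [set_mnm s] is squarefree, raising an already positive exponent of [x] allows no new
    faces. *)
Lemma koszul_colon_pos a s : (0 < a x)%N ->
  koszul_complex Uc a s <-> koszul_complex U (a + U_(x))%MM s.
Proof.
move=> ax; case: (boolP (set_mnm s <= a)%MM) => [/koszul_colonE//|nle].
split=> -[le _]; first by rewrite le in nle.
case/negP: nle; apply/lem_set_mnm => i iNs; move/lem_set_mnm/(_ i iNs): le.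
by rewrite mnmDE mnm1E; case: eqP => [<-|]; rewrite ?addn0.
Qed.

Lemma koszul_colon_free a s : a x = 0%N ->
  koszul_complex Uc a s <-> x \notin s /\ koszul_complex U (a + U_(x))%MM s.
Proof.
move=> ax; split=> [[le h]|[xs [le h]]].
  split; last by apply/koszul_colonE.
  by apply/negP => /(lem_set_mnm _ _ le); rewrite ax.
apply/koszul_colonE; last by split.
apply/lem_set_mnm => i iNs; move/lem_set_mnm/(_ i iNs): le.
rewrite mnmDE mnm1E; case: eqP => [xi|]; rewrite ?addn0 //.
by rewrite xi iNs in xs.
Qed.

Lemma koszul_link (V : 'X_{1..n} -> Prop) a s : a x = 0%N ->
  (x \notin s /\ koszul_complex V (a + U_(x))%MM (x |: s)) <->
  koszul_complex V a s.
Proof.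
move=> ax; have key : x \notin s ->
    koszul_complex V (a + U_(x))%MM (x |: s) <-> koszul_complex V a s.
  move=> xs; rewrite /koszul_complex set_mnmU1 //.
  have -> : (a + U_(x) - (set_mnm s + U_(x)))%MM = (a - set_mnm s)%MM.
    by apply/mnmP => i; rewrite !(mnmDE, mnmBE) subnDr.
  have -> // : (set_mnm s + U_(x) <= a + U_(x))%MM = (set_mnm s <= a)%MM.
  by apply/mnm_lepP/mnm_lepP => h i; move: (h i); rewrite !mnmDE leq_add2r.
split=> [[xs /key]|h]; first exact.
have xs : x \notin s.
  by case: h => /lem_set_mnm le _; apply/negP => /le; rewrite ax.
by split=> //; apply/key.
Qed.

Lemma hom_add_free a m : a x = 0%N -> hom Ua a m <-> hom U a m.
Proof.
by move=> ax; split; apply: hom_neq0_ext => s; rewrite koszul_add_free.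
Qed.

Lemma hom_colon_pos a m : (0 < a x)%N -> hom Uc a m <-> hom U (a + U_(x))%MM m.
Proof.
by move=> ax; split; apply: hom_neq0_ext => s; rewrite koszul_colon_pos.
Qed.

Lemma hom_link_step a m : a x = 0%N -> hom U (a + U_(x))%MM m ->
  hom Uc a m \/ exists2 m', m = m'.+1 & hom U a m'.
Proof.
move=> ax /(hom_deletion_or_link (fun s => @koszul_down _ _ _ x s upU)).
case=> [h|[m' -> h]]; [left|right; exists m' => //]; move: h.
  by apply: hom_neq0_ext => s; rewrite koszul_colon_free.
by apply: hom_neq0_ext => s; apply: koszul_link.
Qed.

Lemma hom_colon_free a m : a x = 0%N -> hom Uc a m ->
  hom U (a + U_(x))%MM m \/ hom U a m.
Proof.
move=> ax /(hom_neq0_ext (fun s => koszul_colon_free s ax)).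
move=> /(hom_deletion (fun s => @koszul_down _ _ _ x s upU))[h|h].
  by left.
by right; move: h; apply: hom_neq0_ext => s; apply: koszul_link.
Qed.

Lemma hom_add_1 a m : a x = 0%N -> hom Ua (a + U_(x))%MM m ->
  (a = 0%MM /\ m = 0%N) \/ exists2 m', m = m'.+1 & hom U a m'.
Proof.
move=> ax /(hom_deletion_or_link (fun s => @koszul_down _ _ _ x s upward_add)).
case=> [|[m' -> h]]; last first.
  right; exists m' => //; apply/(hom_add_free _ ax); move: h.
  by apply: hom_neq0_ext => s; apply: koszul_link.
(* For a face avoiding [x], the quotient monomial keeps its factor [x] and lies in the sum ideal
   automatically, so the deletion is the full simplex on the support of [a]. *)
have simplex s : x \notin s /\ koszul_complex Ua (a + U_(x))%MM s <->
    (set_mnm s <= a)%MM.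
  split=> [[xs [/lem_set_mnm le _]]|/lem_set_mnm le].
    apply/lem_set_mnm => i iNs; move: (le i iNs); rewrite mnmDE mnm1E.
    by case: eqP => [xi|]; rewrite ?addn0 //; rewrite xi iNs in xs.
  have xs : x \notin s by apply/negP => /le; rewrite ax.
  split=> //; split.
    by apply/lem_set_mnm => i /le; rewrite mnmDE; lia.
  by right; rewrite mnmBE mnmDE mnm1E eqxx mnmE (negbTE xs) ax.
move=> /(hom_neq0_ext simplex) h; left.
have a0 : a = 0%MM.
  apply/mnmP => k; rewrite mnm0E; apply/eqP; rewrite -leqn0 leqNgt.
  apply/negP => ak; apply: (hom_cone (k := k)) h => s /lem_set_mnm le.
  by apply/lem_set_mnm => i; rewrite !inE => /orP[/eqP->|/le].
(* At [a] = 0 the empty set is the only face, so a chain on faces of positive cardinality is 0 and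
   bounds. *)
split=> //; case: h => c [hc _ nb]; case: m hc nb => // m hc nb; case: nb.
exists 0 => [s|]; first by rewrite ffunE eqxx.
rewrite raddf0; apply/ffunP => s; rewrite ffunE; apply/esym/eqP;
  apply: contraT => /hc[].
rewrite a0 => /lem_set_mnm le es.
have /card_gt0P[i /le] : (0 < #|s|)%N by rewrite es.
by rewrite mnm0E.
Qed.

(** The exponent of [x] is at least 2, so a factor [x] remains after adding [x] to any face, and the
    complex is a cone with apex [x]. *)
Lemma hom_add_pos a m : (0 < a x)%N -> ~ hom Ua (a + U_(x))%MM m.
Proof.
move=> ax; apply: (hom_cone (k := x)) => s [/lem_set_mnm le _]; split.
  apply/lem_set_mnm => i; rewrite !inE => /orP[/eqP->|/le//].
  by rewrite mnmDE; lia.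
by right; rewrite mnmBE mnmDE mnm1E eqxx mnmE !inE eqxx /=; lia.
Qed.

Lemma split_var a : a x = 0%N \/ exists b, a = (b + U_(x))%MM.
Proof.
case: (posnP (a x)) => [|ax]; [by left|right].
by exists (a - U_(x))%MM; rewrite submK // lep1mP -lt0n.
Qed.

End ColonAdd.

(** * Comparison of the three regularities *)

Theorem lemma2p10 (K : fieldType) (n : nat) (I : {mpoly K[n]} -> Prop) (x :
  'I_n)
    (hI : monomial_ideal I) (hx : appears_in I x) :
  reg I <= Num.max (reg (ideal_colon I 'X_x) + 1) (reg (ideal_add I 'X_x)) /\
  (reg I = reg (ideal_colon I 'X_x) + 1 \/ reg I = reg (ideal_add I 'X_x)).
Proof.
have sI := monomial_ideal_span hI.
have [g [Ig ming] gx] := hx.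
pose U a := I 'X_[a]; rewrite -/U in sI.
have upU : upward U by case: sI.
have Ug : U g by [].
have sc := colon_span x sI; have sa := add_span x sI.
have [ex le] := reg_spec sI Ug.
have [|exc lec] := reg_spec (a0 := g) sc; first exact: upU Ug (lem_addr _ _).
have [|exa lea] := reg_spec (a0 := g) sa; first by left.
set rI := reg I in ex le *; set rc := reg _ in exc lec *.
set ra := reg (ideal_add _ _) in exa lea *.
(* This bound absorbs the exceptional class of [hom_add_1], whose value is 1. It holds because the
   minimal generator [g] is divisible by [x] and so has positive degree. *)
have reg_pos : 1 <= rI.
  have := le g 0%N (hom_minimal K Ug (fun b Ub => ming b Ub)).
  have : (0 < mdeg g)%N.
    by rewrite lt0n mdeg_eq0; apply: contraTneq gx => ->; rewrite mnm0E.
  lia.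
have deg1 (b : 'X_{1..n}) : (mdeg (b + U_(x)))%:Z = (mdeg b)%:Z + 1.
  by rewrite mdegD mdeg1 PoszD.
(* A multidegree attaining [rI] is treated according to its exponent of [x]: 0, at least 2, or
   exactly 1. *)
have upper : rI <= rc + 1 \/ rI <= ra.
  have [a [m [h ->]]] := ex.
  have [ax|[b eb]] := split_var x a.
    by right; apply: lea; apply/hom_add_free.
  move: h; rewrite eb deg1 => h; have [bx|bx] := posnP (b x); last first.
    by left; have := lec b m ((hom_colon_pos _ _ _ bx).2 h); lia.
  have [/lec|[m' -> h']] := hom_link_step upU bx h; first by left; lia.
  by right; have := lea b m' ((hom_add_free _ _ _ bx).2 h'); lia.
have add_le : ra <= rI.
  have [a [m [h ->]]] := exa.
  have [ax|[b eb]] := split_var x a.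
    by apply: le; apply/(hom_add_free _ _ _ ax).
  move: h; rewrite eb deg1; have [bx|bx] := posnP (b x); last first.
    by move=> /(hom_add_pos bx).
  case/(hom_add_1 upU bx) => [[-> ->]|[m' -> /le]]; last by lia.
  by rewrite mdeg0; lia.
have colon_le : ra < rI -> rc + 1 <= rI.
  have [a [m [h ->]]] := exc => lt.
  have [ax|ax] := posnP (a x); last first.
    by move: h => /(hom_colon_pos _ _ _ ax)/le; rewrite deg1; lia.
  have [/le|] := hom_colon_free upU ax h; first by rewrite deg1; lia.
  (* In the link case the value is at most [ra], hence strictly below [rI], and integrality supplies
     the extra 1. *)
  by move=> /(hom_add_free _ _ _ ax)/lea; lia.
have [eq|/colon_le lt] : rI = ra \/ ra < rI by lia.
  by rewrite le_max eq lexx orbT; split=> //; right.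
by rewrite le_max; split; [apply/orP; case: upper; [left|right]|lia].
Qed.
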